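(* Suppose $p_i=2i$ for $i=0,1,\ldots,N$. Then $(c_{IK}(\xi))^2$ is the $[2N/2N]$ Padé approximant of $(c_{WW}(\xi))^2$ (as functions of $h|\xi|$, at $h|\xi|=0$). More precisely, there exists a positive constant $C$ depending only on $N$ such that for any $\xi\in\mathbf{R}^n$ and any $h,g>0$ we have $$\biggl|\biggl(\frac{c_{WW}(\xi)}{\sqrt{gh}}\biggr)^2-\biggl(\frac{c_{IK}(\xi)}{\sqrt{gh}}\biggr)^2\biggr|\leq C(h|\xi|)^{4N+2}.$$
   Context: $n\ge1$, $N\ge 1$ are integers; $g,h>0$. For integers $0=p_0<p_1<\cdots<p_N$ define the $(N+1)\times(N+1)$ matrices $$A_0=\Bigl(\frac{1}{p_i+p_j+1}\Bigr)_{0\le i,j\le N},\qquad A_1=\Bigl(\frac{p_ip_j}{p_i+p_j-1}\Bigr)_{0\le i,j\le N}$$ (with the convention $0/0=0$), $A(h\xi)=(h|\xi|)^2A_0+A_1$ for $\xi\in\mathbf{R}^n$, and, with $\mathbf{1}=(1,\ldots,1)^{\rm T}\in\mathbf{R}^{N+1}$, $$\tilde A(h\xi)=\begin{pmatrix}0&\mathbf{1}^{\rm T}\\-\mathbf{1}&A(h\xi)\end{pmatrix}.$$ The phase speed of the linearized Isobe--Kakinuma model (flat bottom) is $$c_{IK}(\xi)=\pm\sqrt{gh\,\frac{(h|\xi|)^{-2}\det A(h\xi)}{\det\tilde A(h\xi)}},$$ where $(h|\xi|)^{-2}\det A(h\xi)$ and $\det\tilde A(h\xi)$ are polynomials in $(h|\xi|)^2$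 of degree $N$ and the value at $\xi=0$ is understood through these polynomials. The phase speed of linear water waves is $$c_{WW}(\xi)=\pm\sqrt{gh\,\frac{\tanh(h|\xi|)}{h|\xi|}},$$ with $\tanh(s)/s$ read as $1$ at $s=0$. The $[M/K]$ Padé approximant of a function $f(s)$ analytic at $s=0$ is a rational function $P(s)/Q(s)$ with $\deg P\le M$, $\deg Q\le K$, $Q(0)\ne0$ and $f(s)-P(s)/Q(s)=O(s^{M+K+1})$ as $s\to0$. *)

(* Defs.v *)
From HB Require Import structures.
From mathcomp Require Import all_boot all_order all_algebra.
From mathcomp Require Import all_classical all_reals all_analysis.
Set Implicit Arguments.
Unset Strict Implicit.
Unset Printing Implicit Defensive.
Import Order.TTheory GRing.Theory Num.Theory.
Import numFieldNormedType.Exports.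
Local Open Scope classical_set_scope.
Local Open Scope ring_scope.

(* The norm `|xi| of the library on row vectors is the sup norm. *)
Definition enorm (R : realType) (n : nat) (xi : 'rV[R]_n) : R :=
  Num.sqrt (\sum_(i < n) xi 0 i ^+ 2).

Section IsobeKakinuma.
Context (R : realType) (N : nat) (p : 'I_N.+1 -> nat).

Definition A0 : 'M[R]_N.+1 :=
  \matrix_(i, j) ((p i)%:R + (p j)%:R + 1)^-1.

(* Division by zero yields 0, which is the convention 0/0 = 0. *)
Definition A1 : 'M[R]_N.+1 :=
  \matrix_(i, j) ((p i)%:R * (p j)%:R / ((p i)%:R + (p j)%:R - 1)).

(* Throughout, s stands for h|xi|. *)
Definition A (s : R) : 'M[R]_N.+1 := s ^+ 2 *: A0 + A1.

Definition bordered (S : pzRingType) (M : 'M[S]_N.+1) : 'M[S]_(1 + N.+1) :=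
  block_mx 0 (const_mx 1) (- const_mx 1) M.

Definition Atilde (s : R) : 'M[R]_(1 + N.+1) := bordered (A s).

(* A(h xi) as a matrix of polynomials in the indeterminate (h|xi|)^2. *)
Definition Apoly : 'M[{poly R}]_N.+1 :=
  'X *: map_mx polyC A0 + map_mx polyC A1.

(* The polynomials whose values at s^2 are s^-2 * det A(s) and det Atilde(s);
   see [IKnumE] and [IKdenE]. They give the meaning of the phase speed at
   s = 0. *)
Definition IKnum : {poly R} := \det Apoly %/ 'X.
Definition IKden : {poly R} := \det (bordered Apoly).

Lemma map_Apoly (s : R) : map_mx (horner_eval (s ^+ 2)) Apoly = A s.
Proof.
apply/matrixP => i j; rewrite !mxE /horner_eval.
by rewrite hornerD hornerM hornerX !hornerC.
Qed.

Lemma IKdenE (s : R) : IKden.[s ^+ 2] = \det (Atilde s).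
Proof.
rewrite -[LHS]/(horner_eval _ _) -det_map_mx /bordered map_block_mx map_Apoly.
by rewrite map_mx0 map_mxN !map_const_mx /= /horner_eval hornerC.
Qed.

Lemma IKnumE (s : R) : p ord0 = 0%N -> s != 0 ->
  IKnum.[s ^+ 2] = s ^- 2 * \det (A s).
Proof.
move=> p0 s0.
have evA t : (\det Apoly).[t ^+ 2] = \det (A t).
  by rewrite -[LHS]/(horner_eval _ _) -det_map_mx map_Apoly.
have dvdX : 'X %| \det Apoly.
  rewrite -['X]subr0 -polyC0 dvdp_XsubCl /root.
  have := evA 0; rewrite expr0n => ->.
  rewrite (expand_det_row _ ord0) big1 // => j _.
  by rewrite !mxE p0 expr0n !mul0r addr0 mul0r.
rewrite -(evA s) -[in RHS](divpK dvdX) -/IKnum hornerM hornerX mulrCA.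
by rewrite mulVf ?mulr1 // expf_neq0.
Qed.

End IsobeKakinuma.

(* The boolean selects the sign in +/-. *)
Definition cIK_of (R : realType) (N : nat) (p : 'I_N.+1 -> nat) (b : bool)
    (g h s : R) : R :=
  (-1) ^+ b *
  Num.sqrt (g * h * ((IKnum R p).[s ^+ 2] / (IKden R p).[s ^+ 2])).

Definition cIK (R : realType) (N : nat) (p : 'I_N.+1 -> nat) (b : bool)
    (g h : R) (n : nat) (xi : 'rV[R]_n) : R :=
  cIK_of p b g h (h * enorm xi).

Definition tanh (R : realType) (s : R) : R :=
  (expR s - expR (- s)) / (expR s + expR (- s)).

Definition tanhc (R : realType) (s : R) : R :=
  if s == 0 then 1 else tanh s / s.

Definition cWW_of (R : realType) (b : bool) (g h s : R) : R :=
  (-1) ^+ b * Num.sqrt (g * h * tanhc s).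

Definition cWW (R : realType) (b : bool) (g h : R) (n : nat)
    (xi : 'rV[R]_n) : R :=
  cWW_of b g h (h * enorm xi).

Definition analytic_at0 (R : realType) (f : R -> R) : Prop :=
  exists (a : nat -> R) (r : R), 0 < r /\
    forall s : R, `|s| < r -> pseries a s @ \oo --> f s.

(* phi is an [M/K] Pade approximant of f at 0. *)
Definition is_pade (R : realType) (M K : nat) (f phi : R -> R) : Prop :=
  analytic_at0 f /\
  exists P Q : {poly R},
    [/\ (size P <= M.+1)%N, (size Q <= K.+1)%N, Q.[0] != 0,
        forall s : R, phi s = P.[s] / Q.[s] &
        (fun s : R => f s - P.[s] / Q.[s])
          =O_ (0 : R) (fun s : R => s ^+ (M + K + 1))].

(* Main.v *)
Require Import Defs.
From mathcomp Require Import all_boot all_order all_algebra all_fingroup.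
From mathcomp Require Import all_classical all_reals all_analysis.
From mathcomp Require Import ring lra zify.
Set Implicit Arguments.
Unset Strict Implicit.
Unset Printing Implicit Defensive.
Import Order.TTheory GRing.Theory Num.Theory.
Import numFieldNormedType.Exports.
Local Open Scope classical_set_scope.
Local Open Scope ring_scope.

(** The model is a Galerkin discretization of the water-wave problem, and a
Galerkin energy converges at twice the rate of the approximation: this is
where the exponent [4N+2] comes from.

Write [s = h|xi|]. The matrix [A s] is the Gram matrix, on the even
polynomials [z^(2i)], [i <= N], of the energy
[E(v) = int_0^1 s^2 v(z)^2 + v'(z)^2 dz]. Solving the bordered system
([bordered_solve]) produces the minimizer of [E] among the even polynomials
of degree at most [2N] with [v(1) = 1], and by taking determinants its energy
is [a = det (A s) / det (Atilde s)]; so the squared phase speed of the model is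
[a / s^2] up to the factor [gh]. On the other hand [s * tanh s] is the minimum
of [E] over all functions with [v(1) = 1], attained at
[w(z) = cosh (s z) / cosh s], and
[E(v) - s * tanh s = E(v - w) >= 0] whenever [v(1) = 1] ([energy_gap]).

Hence [a >= s * tanh s] ([galerkin_lower]). For the upper bound one tests with
a polynomial: the even Taylor polynomial of [cosh (s z)], corrected by a
constant to have the right value at [z = 1], is at distance [O(s^(2N+2))] of
[w] together with its derivative, and [E] squares this distance, so
[a <= s * tanh s + O(s^(4N+4))] for [s <= 1] ([galerkin_upper]). The test
function [1] gives [a <= s^2], that is a ratio at most [1], which takes care of
[s >= 1]. Dividing by [s^2] yields the estimate with [s^(4N+2)]
([speed_ratio_tanhc]); the value at [s = 0] follows by continuity, since
[det (Atilde 0)] does not vanish ([bordered_A_neq0], [speed_ratio0]).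

For the Pade property two more facts are needed. The numerator and the
denominator have degree at most [N] in [s^2] ([size_IKnum], [size_IKden]). And
[tanh s / s] is the sum of a power series near [0] ([tanhc_analytic]); this is
the quotient of two power series with bounded coefficients ([analytic_div]). *)

(** * Hyperbolic functions and their Taylor remainders *)

Section Calculus.
Context {R : realType}.
Implicit Types (f df : R -> R) (x s : R) (n : nat).

Lemma mean_value f df (a b : R) :
  a <= b -> (forall x, is_derive x (1 : R) f (df x)) ->
  exists2 c, a <= c <= b & f b - f a = df c * (b - a).
Proof.
move=> ab fdf; have cf : {within `[a, b], continuous f}.
  apply: derivable_within_continuous => x _.
  by have [] := fdf x.
have [c + e] := MVT_segment ab (fun x _ => fdf x) cf.
by rewrite in_itv /= => cab; exists c.
Qed.

Lemma is_derive_scale f df (k x : R) :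
  (forall y, is_derive y (1 : R) f (df y)) ->
  is_derive x (1 : R) (fun z => f (k * z)) (k * df (k * x)).
Proof.
move=> fdf; have hl : is_derive x (1 : R) (fun z : R => k * z) k.
  apply: (is_derive_eq (is_deriveZ k (is_derive_id x 1))).
  by rewrite /= /GRing.scale /= mulr1.
rewrite mulrC; exact: (@is_derive1_comp _ f _ _ _ _ (fdf _) hl).
Qed.

Definition cosh x : R := (expR x + expR (- x)) / 2.
Definition sinh x : R := (expR x - expR (- x)) / 2.

Lemma is_derive_expRN x : is_derive x (1 : R) (fun z => expR (- z)) (- expR (- x)).
Proof.
have := @is_derive_scale expR expR (-1) x (@is_derive_expR R).
by rewrite !mulN1r; under eq_fun do rewrite mulN1r.
Qed.

Lemma is_derive_cosh x : is_derive x (1 : R) cosh (sinh x).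
Proof.
have h := is_deriveM (is_deriveD (is_derive_expR x) (is_derive_expRN x))
  (is_derive_cst (2^-1 : R) x 1).
by apply: (is_derive_eq h); rewrite /cst /= /GRing.scale /= /sinh; ring.
Qed.

Lemma is_derive_sinh x : is_derive x (1 : R) sinh (cosh x).
Proof.
have h := is_deriveM (is_deriveB (is_derive_expR x) (is_derive_expRN x))
  (is_derive_cst (2^-1 : R) x 1).
by apply: (is_derive_eq h); rewrite /cst /= /GRing.scale /= /cosh; ring.
Qed.

Lemma sinh0 : sinh 0 = 0. Proof. by rewrite /sinh oppr0 subrr mul0r. Qed.

Lemma cosh0 : cosh 0 = 1. Proof. by rewrite /cosh oppr0 expR0; field. Qed.

Lemma cosh_ge1 x : 1 <= cosh x.
Proof.
have := expR_ge1Dx x; have := expR_ge1Dx (- x).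
by rewrite /cosh; lra.
Qed.

Lemma cosh_gt0 x : 0 < cosh x.
Proof. by have := cosh_ge1 x; lra. Qed.

Lemma tanh_cosh x : tanh x = sinh x / cosh x.
Proof.
have := cosh_gt0 x; rewrite /tanh /sinh /cosh => h.
by field; lra.
Qed.

Lemma tanhcN x : tanhc (- x) = tanhc x.
Proof.
rewrite /tanhc oppr_eq0; case: eqP => // _.
by rewrite /tanh opprK invrN mulrN -mulNr -mulNr opprB [expR (- x) + _]addrC.
Qed.

Lemma tanhc_mul x : x * tanhc x = tanh x.
Proof.
rewrite /tanhc; case: eqP => [->|/eqP x0]; last by rewrite mulrC divfK.
by rewrite mul0r tanh_cosh sinh0 mul0r.
Qed.

Definition cosh_trunc n : {poly R} :=
  \sum_(i < n) ((2 * i)`!%:R^-1) *: 'X^(2 * i).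
Definition sinh_trunc n : {poly R} :=
  \sum_(i < n) ((2 * i).+1`!%:R^-1) *: 'X^((2 * i).+1).

Lemma factSV (m : nat) : (m.+1`!%:R^-1 : R) *+ m.+1 = m`!%:R^-1.
Proof.
by rewrite -[LHS]mulr_natr factS natrM invfM mulrAC mulVf ?mul1r ?pnatr_eq0.
Qed.

Lemma deriv_sinh_trunc n : (sinh_trunc n)^`() = cosh_trunc n.
Proof.
rewrite /sinh_trunc raddf_sum; apply: eq_bigr => i _ /=.
by rewrite derivZ derivXn -scalerMnr scalerMnl factSV.
Qed.

Lemma deriv_cosh_trunc n : (cosh_trunc n.+1)^`() = sinh_trunc n.
Proof.
rewrite /cosh_trunc raddf_sum big_ord_recl /= derivZ derivXn /= mulr0n scaler0.
rewrite add0r; apply: eq_bigr => i _ /=.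
by rewrite mulnS addSn add1n derivZ derivXn -scalerMnr scalerMnl factSV.
Qed.

Lemma cosh_trunc0 n : (cosh_trunc n.+1).[0] = 1.
Proof.
rewrite horner_sum big_ord_recl big1 => [|i _].
  by rewrite hornerZ hornerXn muln0 expr0 fact0 invr1 mulr1 addr0.
by rewrite hornerZ hornerXn /= mulnS expr0n mulr0.
Qed.

Lemma sinh_trunc0 n : (sinh_trunc n).[0] = 0.
Proof.
by rewrite horner_sum big1 // => i _; rewrite hornerZ hornerXn expr0n mulr0.
Qed.

(** Integrating a power bound raises the exponent by one: each step of the
Taylor remainder estimate below is one such integration. *)
Lemma integrate_bound f df (K : R) (m : nat) :
  (forall x, is_derive x (1 : R) f (df x)) -> f 0 = 0 -> 0 <= K ->
  (forall x, 0 <= x <= 1 -> `|df x| <= K * x ^+ m) ->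
  forall x, 0 <= x <= 1 -> `|f x| <= K * x ^+ m.+1.
Proof.
move=> fdf f0 K0 b x /andP[x0 x1].
have [c /andP[c0 cx]] := mean_value x0 fdf.
rewrite f0 !subr0 => ->; rewrite normrM (ger0_norm x0) exprSr mulrA.
apply: ler_wpM2r => //; apply: le_trans (b c _) _; first by rewrite c0 (le_trans cx).
by apply: ler_wpM2l => //; apply: lerXn2r; rewrite ?nnegrE.
Qed.

(** The remainders of [cosh] and [sinh] are successive primitives of [cosh],
vanishing at [0], so [integrate_bound] applies alternately to the two. The
constant [expR 1] is a bound of [cosh] on the unit interval. *)
Lemma hyperbolic_remainder n :
  (forall x, 0 <= x <= 1 ->
    `|cosh x - (cosh_trunc n).[x]| <= expR 1 * x ^+ (2 * n)) /\
  (forall x, 0 <= x <= 1 ->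
    `|sinh x - (sinh_trunc n).[x]| <= expR 1 * x ^+ (2 * n).+1).
Proof.
have K0 : 0 <= expR 1 :> R by exact: expR_ge0.
have hs m : (forall x, 0 <= x <= 1 ->
    `|cosh x - (cosh_trunc m).[x]| <= expR 1 * x ^+ (2 * m)) ->
  (forall x, 0 <= x <= 1 ->
    `|sinh x - (sinh_trunc m).[x]| <= expR 1 * x ^+ (2 * m).+1).
  apply: (@integrate_bound (sinh - horner (sinh_trunc m))) => // [x|].
    rewrite -deriv_sinh_trunc.
    exact: is_deriveB (is_derive_sinh x) (is_derive_poly _ x).
  by rewrite !fctE sinh0 sinh_trunc0 subrr.
elim: n => [|n [_ ih]].
  suff h : forall x, 0 <= x <= 1 ->
    `|cosh x - (cosh_trunc 0).[x]| <= expR 1 * x ^+ (2 * 0)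
    by split=> //; exact: hs.
  move=> x /andP[x0 x1]; rewrite /cosh_trunc big_ord0 horner0 subr0 muln0 expr0.
  rewrite mulr1 ger0_norm; last exact: ltW (cosh_gt0 x).
  rewrite /cosh.
  have : expR x <= expR 1 by rewrite ler_expR.
  have : expR (- x) <= expR 1 by rewrite ler_expR; lra.
  lra.
suff h : forall x, 0 <= x <= 1 ->
  `|cosh x - (cosh_trunc n.+1).[x]| <= expR 1 * x ^+ (2 * n.+1)
  by split=> //; exact: hs.
rewrite mulnS addSn add1n.
apply: (@integrate_bound (cosh - horner (cosh_trunc n.+1)) _ _ _ _ _ K0 ih).
  move=> x.
  rewrite -deriv_cosh_trunc.
  exact: is_deriveB (is_derive_cosh x) (is_derive_poly _ x).
by rewrite !fctE cosh0 cosh_trunc0 subrr.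
Qed.

(** With [w z = cosh (s z) / cosh s], the left-hand side is the energy of
[P - w] over the unit interval, and the right-hand side its integrand at an
intermediate point. Indeed [w'' = s^2 w], so an antiderivative of that integrand
is [J - 2 P w' + w w']; it vanishes at [0] since [w' 0 = 0], and at [1] its
value is [J 1 - w' 1 = J 1 - s tanh s] since [P 1 = w 1 = 1]. The mean value
theorem concludes. The same identity serves for the lower
bound (the integrand is nonnegative) and for the upper bound (it is small). *)
Lemma energy_gap (P J : {poly R}) s :
  J^`() = s ^+ 2 *: P ^+ 2 + P^`() ^+ 2 -> J.[0] = 0 -> P.[1] = 1 ->
  exists2 c, 0 <= c <= 1 & J.[1] - s * tanh s =
    s ^+ 2 * (P.[c] - cosh (s * c) / cosh s) ^+ 2
    + (P^`().[c] - s * sinh (s * c) / cosh s) ^+ 2.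
Proof.
move=> dJ J0 P1; have chn0 : cosh s != 0 by rewrite gt_eqF ?cosh_gt0.
pose w z := cosh (s * z) * (cosh s)^-1.
pose w' z := s * sinh (s * z) * (cosh s)^-1.
pose G := horner J + (w - 2 \*: horner P) * w'.
have dw x : is_derive x (1 : R) w (w' x).
  have h := is_deriveM (is_derive_scale s x is_derive_cosh)
    (is_derive_cst ((cosh s)^-1 : R) x 1).
  by apply: (is_derive_eq h); rewrite /cst /= /GRing.scale /= /w'; ring.
have dw' x : is_derive x (1 : R) w' (s ^+ 2 * w x).
  have h := is_deriveM (is_deriveZ s (is_derive_scale s x is_derive_sinh))
    (is_derive_cst ((cosh s)^-1 : R) x 1).
  by apply: (is_derive_eq h); rewrite /cst /= /GRing.scale /= /w; ring.
have dG x : is_derive x (1 : R) G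
    (s ^+ 2 * (P.[x] - w x) ^+ 2 + (P^`().[x] - w' x) ^+ 2).
  have h := is_deriveD (is_derive_poly J x)
    (is_deriveM (is_deriveB (dw x) (is_deriveZ 2 (is_derive_poly P x))) (dw' x)).
  apply: (is_derive_eq h).
  rewrite -[(w - _) x]/(w x - 2 * P.[x]) dJ hornerD hornerZ !horner_exp.
  by rewrite /GRing.scale /=; ring.
have [c c01 e] := mean_value ler01 dG; exists c => //.
move: e; rewrite subr0 mulr1 -/(w c) -/(w' c) => <-.
rewrite -[G 1]/(J.[1] + (w 1 - 2 * P.[1]) * w' 1).
rewrite -[G 0]/(J.[0] + (w 0 - 2 * P.[0]) * w' 0).
rewrite J0 P1 /w /w' !mulr0 !mulr1 sinh0 tanh_cosh; by field.
Qed.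

End Calculus.

(** * Bordered matrices and constrained minimization *)

Section Bordered.
Context {F : fieldType} {N : nat}.
Implicit Types (M : 'M[F]_N.+1) (u v t : 'rV[F]_N.+1).

Definition qform M v : F := (v *m M *m v^T) 0 0.

Lemma mulmx_const v (a : F) : v *m const_mx a = (a * \sum_i v 0 i)%:M :> 'M[F]_1.
Proof.
apply/matrixP => i j; rewrite !ord1 !mxE mulr1n mulr_sumr.
by apply: eq_bigr => k _; rewrite mxE mulrC.
Qed.

(** The Euler-Lagrange equation of the constrained problem: when [v M] is a
multiple of the constraint, [v] pairs with [t] through the constraint only. *)
Lemma qform_eigen M v t (a : F) :
  v *m M = const_mx a -> v *m M *m t^T = (a * \sum_i t 0 i)%:M.
Proof.
move=> ->; apply/matrixP => i j; rewrite !ord1 !mxE mulr1n mulr_sumr.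
by apply: eq_bigr => k _; rewrite !mxE.
Qed.

Lemma bordered_mul M (x : F) v :
  row_mx x%:M v *m bordered M =
  row_mx (- \sum_i v 0 i)%:M (const_mx x + v *m M).
Proof.
rewrite /bordered mul_row_block mulmx0 add0r mulmxN mulmx_const mul1r raddfN /=.
congr (row_mx _ (_ + _)); apply/matrixP => i j.
by rewrite !mxE big_ord1 !mxE !ord1 mulr1n mulr1.
Qed.

(** A kernel vector [(x, v)] of the bordered matrix satisfies the homogeneous
constraint and [v M = - x 1], so its quadratic form vanishes. *)
Lemma bordered_unit M :
  (forall v, \sum_i v 0 i = 0 -> qform M v = 0 -> v = 0) ->
  \det (bordered M) != 0.
Proof.
move=> definite; apply/negP => /det0P[w w0 wM].
case/eqP: w0; rewrite -[w]hsubmxK in wM *.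
rewrite [lsubmx w]mx11_scalar in wM *.
move: wM; set x := lsubmx w 0 0; set v := rsubmx w.
rewrite bordered_mul -[0 in RHS]row_mx0 => /eq_row_mx[sv vM].
have {}sv : \sum_i v 0 i = 0.
  move/matrixP/(_ 0 0): sv; rewrite !mxE mulr1n => /eqP.
  by rewrite oppr_eq0 => /eqP.
have {}vM : v *m M = const_mx (- x).
  apply/matrixP => i j; move/matrixP/(_ i j): vM; rewrite !mxE => /eqP.
  by rewrite addrC addr_eq0 => /eqP.
have v0 : v = 0.
  by apply: definite => //; rewrite /qform (qform_eigen _ vM) sv mulr0 mxE mul0rn.
move: vM; rewrite v0 mul0mx => /matrixP/(_ 0 0); rewrite !mxE => /eqP.
by rewrite eq_sym oppr_eq0 => /eqP ->; rewrite raddf0 row_mx0.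
Qed.

(** The row [(a, - u)] is the first row of the inverse of the bordered matrix.
The relation between determinants is Cramer's rule: replacing the first row of
the identity by [(a, - u)] and multiplying by the bordered matrix leaves a block
lower triangular matrix with diagonal blocks [1] and [M]. *)
Lemma bordered_solve M : \det (bordered M) != 0 ->
  exists (a : F) u, [/\ \sum_i u 0 i = 1, u *m M = const_mx a
                      & a * \det (bordered M) = \det M].
Proof.
move=> d0; have Mu : bordered M \in unitmx by rewrite unitmxE unitfE.
pose w : 'rV[F]_(1 + N.+1) := row_mx 1%:M 0 *m invmx (bordered M).
have wM : row_mx (lsubmx w 0 0)%:M (rsubmx w) *m bordered M = row_mx 1%:M 0.
  by rewrite -mx11_scalar hsubmxK mulmxKV.
move: wM; set x := lsubmx w 0 0; set v := rsubmx w => wM.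
have [sv vM] : - (\sum_i v 0 i) = 1 /\ const_mx x + v *m M = 0.
  move: wM; rewrite bordered_mul => /eq_row_mx[/matrixP/(_ 0 0) + ->].
  by rewrite !mxE !mulr1n.
exists x, (- v); split.
- by rewrite -sv -sumrN; apply: eq_bigr => i _; rewrite mxE.
- by apply/eqP; rewrite mulNmx eq_sym -addr_eq0 vM.
have : \det (block_mx x%:M v 0 1%:M *m bordered M) = \det M.
  rewrite [bordered M]/bordered /bordered in wM *.
  have -> : block_mx x%:M v 0 1%:M *m block_mx 0 (const_mx 1) (- const_mx 1) M
     = block_mx 1%:M 0 (- const_mx 1) M :> 'M[F]_(1 + N.+1).
    rewrite [LHS]mulmx_block !mul0mx !mul1mx !add0r.
    move: wM; rewrite mul_row_block => /eq_row_mx[-> ->].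
    by [].
  by rewrite det_lblock det1 mul1r.
by rewrite det_mulmx det_ublock det1 mulr1 det_scalar1.
Qed.

(** Pythagoras: [t - u] satisfies the homogeneous constraint, hence is
orthogonal to [u]. If the form is nonnegative, [u] is thus the constrained
minimizer and [a] the minimum. *)
Lemma qform_min M u t (a : F) : M^T = M ->
  \sum_i u 0 i = 1 -> u *m M = const_mx a -> \sum_i t 0 i = 1 ->
  qform M t = a + qform M (t - u).
Proof.
move=> Msym su uM st; pose d := t - u.
have sd : \sum_i d 0 i = 0.
  transitivity (\sum_i (t 0 i - u 0 i)).
    by apply: eq_bigr => i _; rewrite !mxE.
  by rewrite sumrB st su subrr.
have ud : u *m M *m d^T = 0 by rewrite (qform_eigen _ uM) sd mulr0 raddf0.
have du : d *m M *m u^T = 0.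
  by apply: trmx_inj; rewrite trmx0 !trmx_mul trmxK Msym mulmxA.
have -> : qform M t = qform M (d + u) by rewrite subrK.
rewrite -/d /qform; clearbody d; rewrite linearD /= !mulmxDl !mulmxDr ud du.
rewrite (qform_eigen _ uM) su mulr1 addr0 add0r.
by rewrite mxE [a%:M _ _]mxE mulr1n addrC.
Qed.

End Bordered.

(** * Degrees of the numerator and of the denominator *)

Lemma size_prod_le (S : comNzRingType) (I : finType)
    (f : I -> {poly S}) (d : I -> nat) :
  (forall i, (size (f i) <= (d i).+1)%N) ->
  (size (\prod_i f i)%R <= (\sum_i d i).+1)%N.
Proof.
move=> h; apply: (big_ind2 (fun (q : {poly S}) m => size q <= m.+1)%N) => //.
  by rewrite size_poly1.
move=> q1 m1 q2 m2 h1 h2; apply: leq_trans (size_polyMleq _ _) _; lia.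
Qed.

Section Degrees.
Context {R : realType} {N : nat} (p : 'I_N.+1 -> nat).

Lemma size_Apoly i j : (size (Apoly R p i j) <= 2)%N.
Proof.
rewrite !mxE mulrC; apply: leq_trans (size_polyD _ _) _; rewrite geq_max.
rewrite mul_polyC (leq_trans (size_scale_leq _ _)) ?size_polyX //=.
by rewrite (leq_trans (size_polyC_leq1 _)).
Qed.

Lemma size_IKnum : (size (IKnum R p) <= N.+1)%N.
Proof.
rewrite /IKnum size_divp ?polyX_eq0 // size_polyX subn1.
suff : (size (\det (Apoly R p)) <= N.+2)%N by case: (size _).
apply: leq_trans (size_sum _ _ _) _; apply/bigmax_leqP => s _.
rewrite size_Msign; apply: leq_trans (@size_prod_le _ _ _ (fun=> 1%N) _) _.
  by move=> i; exact: size_Apoly.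
by rewrite sum1_card card_ord.
Qed.

(** A permutation with a nonzero contribution takes one constant entry in the
first row and another one in the first column, which leaves [N] entries of
degree at most one. *)
Lemma size_IKden : (size (IKden R p) <= N.+1)%N.
Proof.
apply: leq_trans (size_sum _ _ _) _; apply/bigmax_leqP => s _.
rewrite size_Msign; have [s0|s0] := eqVneq (s 0) 0.
  rewrite (bigD1 0) //= s0.
  have -> : bordered (Apoly R p) 0 0 = 0.
    have -> : 0 = lshift N.+1 0 :> 'I_(1 + N.+1) by exact: val_inj.
    by rewrite /bordered block_mxEul mxE.
  by rewrite mul0r size_poly0.
apply: leq_trans
  (@size_prod_le _ _ _ (fun i => (i != 0) && (s i != 0) : nat) _) _.
  move=> i; rewrite /bordered; case: (@split_ordP 1 N.+1 i) => i' ->.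
    case: (@split_ordP 1 N.+1 (s (lshift N.+1 i'))) => j ->.
      by rewrite block_mxEul mxE size_poly0.
    by rewrite block_mxEur mxE size_poly1.
  case: (@split_ordP 1 N.+1 (s (rshift 1 i'))) => j ->.
    by rewrite block_mxEdl !mxE size_polyN size_poly1.
  by rewrite block_mxEdr; exact: size_Apoly.
rewrite ltnS -big_mkcond sum1_card.
have -> : #|[pred i | (i != 0) && (s i != 0)]| = #|~: [set 0; (s^-1)%g 0]|.
  apply: eq_card => i; rewrite !inE negb_or; congr (_ && ~~ _).
  by apply/eqP/eqP => [<-|->]; rewrite ?permK ?permKV.
rewrite cardsCs finset.setCK cards2 card_ord.
suff -> : 0 != (s^-1)%g 0 by lia.
by apply: contra s0 => /eqP e; rewrite {1}e permKV.
Qed.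

End Degrees.

(** * The energy of an even polynomial *)

(** The points [1 / (i + 1)] are as many roots as one wishes. *)
Lemma poly_vanish (F : numFieldType) (q : {poly F}) :
  (forall x, 0 <= x <= 1 -> q.[x] = 0) -> q = 0.
Proof.
move=> q0; pose rs := [seq (i.+1%:R^-1 : F) | i <- iota 0 (size q)].
apply: (@roots_geq_poly_eq0 _ q rs); last by rewrite size_map size_iota.
  apply/allP => _ /mapP[i _ ->]; apply/eqP/q0.
  by rewrite invr_ge0 ler0n /= invf_le1 ?ltr0n // ler1n.
rewrite map_inj_uniq ?iota_uniq // => i j /invr_inj/eqP.
by rewrite eqr_nat eqSS => /eqP.
Qed.

Section Energy.
Context {R : realType} {N : nat}.
Implicit Types (s : R) (u v t : 'rV[R]_N.+1).

Definition evens (i : 'I_N.+1) : nat := (2 * i)%N.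

Definition trial v : {poly R} := \sum_i v 0 i *: 'X^(2 * i).

(** The polynomial [int_0^z s^2 y^(a+b) + (y^a)' (y^b)' dy]. For [a = b = 0]
the truncated exponent is harmless because the coefficient vanishes. *)
Definition monomial_energy s (a b : nat) : {poly R} :=
  (s ^+ 2 * (a%:R + b%:R + 1)^-1) *: 'X^(a + b + 1)
  + (a%:R * b%:R / (a%:R + b%:R - 1)) *: 'X^(a + b - 1).

(** The energy of [trial v] on the interval from [0] to [z], as a polynomial
in [z]. *)
Definition energy s v : {poly R} :=
  \sum_i \sum_j (v 0 i * v 0 j) *: monomial_energy s (2 * i) (2 * j).

Lemma deriv_monomial_energy s a b :
  (monomial_energy s a b)^`() =
  s ^+ 2 *: ('X^a * 'X^b) + 'X^a^`() * 'X^b^`().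
Proof.
rewrite /monomial_energy derivD !derivZ !derivXn; congr (_ + _).
  have d0 : a%:R + b%:R + 1 != 0 :> R by rewrite -natrD natr1 pnatr_eq0.
  rewrite addn1 /= -scalerMnr scalerMnl -exprD; congr (_ *: _).
  by rewrite -[LHS]mulr_natr -[(a + b).+1]addn1 !natrD divfK.
case: a => [|a]; first by rewrite mul0r mul0r scale0r mulr0n mul0r.
case: b => [|b]; first by rewrite mulr0 mul0r scale0r mulr0n mulr0.
rewrite addSn addnS subn1 /= -scalerMnr scalerMnl [RHS]mulrnAl [in RHS]mulrnAr -exprD.
rewrite -[RHS]mulrnA -[RHS]scaler_nat; congr (_ *: _).
have -> : a.+1%:R + b.+1%:R - 1 = (a + b).+1%:R :> R.
  by rewrite -!natr1 natrD; ring.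
by rewrite -[LHS]mulr_natr divfK ?pnatr_eq0 // natrM mulrC.
Qed.

Lemma deriv_energy s v :
  (energy s v)^`() = s ^+ 2 *: trial v ^+ 2 + (trial v)^`() ^+ 2.
Proof.
rewrite /trial /energy !raddf_sum /= !expr2 !mulr_suml scaler_sumr -big_split.
apply: eq_bigr => i _ /=; rewrite !mulr_sumr scaler_sumr raddf_sum -big_split.
apply: eq_bigr => j _ /=; rewrite derivZ deriv_monomial_energy !derivZ.
by rewrite -!scalerAl -!scalerAr scalerDr !scalerA; congr (_ *: _ + _); ring.
Qed.

Lemma energy0 s v : (energy s v).[0] = 0.
Proof.
rewrite horner_sum big1 // => i _; rewrite horner_sum big1 // => j _.
rewrite hornerZ hornerD !hornerZ !hornerXn addn1 expr0n mulr0 add0r.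
have [->|i0] := posnP i; first by rewrite muln0 !mul0r mulr0.
rewrite [X in 0 ^+ X](_ : _ = (2 * i + 2 * j - 2).+1); last by lia.
by rewrite expr0n !mulr0.
Qed.

Lemma energy1 s v : (energy s v).[1] = qform (A evens s) v.
Proof.
rewrite /qform mxE /energy exchange_big /= horner_sum; apply: eq_bigr => i _.
rewrite mxE mulr_suml horner_sum; apply: eq_bigr => j _.
rewrite hornerZ hornerD !hornerZ !hornerXn !expr1n !mxE /evens.
by rewrite !mulr1 mulrAC.
Qed.

Lemma trial1 v : (trial v).[1] = \sum_i v 0 i.
Proof.
by rewrite horner_sum; apply: eq_bigr => i _; rewrite hornerZ hornerXn expr1n mulr1.
Qed.

Lemma coef_trial v (i : 'I_N.+1) : (trial v)`_(2 * i) = v 0 i.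
Proof.
rewrite coef_sum (bigD1 i) //= coefZ coefXn eqxx mulr1 big1 ?addr0 // => j ji.
by rewrite coefZ coefXn eqn_mul2l /= eq_sym (inj_eq val_inj) (negbTE ji) mulr0.
Qed.

Lemma A_sym s : (A evens s)^T = A evens s.
Proof.
apply/matrixP => i j; rewrite !mxE.
by rewrite [_%:R + (evens j)%:R]addrC [_%:R * (evens j)%:R]mulrC.
Qed.

Lemma energy_deriv_ge0 s v (x : R) : 0 <= (energy s v)^`().[x].
Proof.
rewrite deriv_energy hornerD hornerZ !horner_exp.
by rewrite addr_ge0 ?sqr_ge0 // mulr_ge0 ?sqr_ge0.
Qed.

Lemma energy_homo s v (x y : R) : x <= y -> (energy s v).[x] <= (energy s v).[y].
Proof.
move=> xy; rewrite -subr_ge0.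
have [c _ ->] := mean_value xy (is_derive_poly (energy s v)).
by rewrite mulr_ge0 ?subr_ge0 // energy_deriv_ge0.
Qed.

Lemma qform_ge0 s v : 0 <= qform (A evens s) v.
Proof. by rewrite -energy1 -(energy0 s v) energy_homo. Qed.

(** The form alone is only semidefinite for [s = 0], where constants have zero
energy; the constraint excludes them. Treating all [s] at once is what gives a
nonzero denominator at [0]. *)
Lemma qform_definite s v :
  \sum_i v 0 i = 0 -> qform (A evens s) v = 0 -> v = 0.
Proof.
move=> sv qv; have E0 : energy s v = 0.
  apply: poly_vanish => x /andP[x0 x1]; apply/eqP; rewrite eq_le.
  by rewrite -{1}qv -energy1 -(energy0 s v) !energy_homo.
have dP : (trial v)^`() = 0.
  apply: poly_vanish => x _; have := congr1 (horner^~ x) (deriv_energy s v).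
  rewrite E0 deriv0 hornerD hornerZ !horner_exp horner0 => /esym/eqP.
  rewrite paddr_eq0 ?sqr_ge0 ?(mulr_ge0 (sqr_ge0 _)) ?sqr_ge0 // => /andP[_].
  by rewrite expf_eq0 /= => /eqP.
have v0 (i : 'I_N.+1) : (0 < i)%N -> v 0 i = 0.
  move=> i0; rewrite -coef_trial.
  have := congr1 (fun q : {poly R} => q`_(2 * i).-1) dP.
  rewrite coef_deriv coef0 prednK ?muln_gt0 // => /eqP.
  by rewrite mulrn_eq0 muln_eq0 /= eqn0Ngt i0 /= => /eqP.
apply/rowP => i; rewrite mxE; have [i0|/v0//] := posnP i.
by rewrite -sv (bigD1 i) //= big1 ?addr0 // => j ji; apply: v0; rewrite lt0n -i0.
Qed.

Lemma bordered_A_neq0 s : \det (Atilde evens s) != 0.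
Proof. by apply: bordered_unit => v; exact: qform_definite. Qed.

Lemma galerkin_lower s v :
  \sum_i v 0 i = 1 -> s * tanh s <= qform (A evens s) v.
Proof.
move=> sv; have P1 : (trial v).[1] = 1 by rewrite trial1.
have [c _] := energy_gap (deriv_energy s v) (energy0 s v) P1.
by rewrite energy1 -subr_ge0 => ->; rewrite addr_ge0 ?sqr_ge0 // mulr_ge0 ?sqr_ge0.
Qed.

(** Coefficients of the Taylor polynomial of [w z = cosh (s z) / cosh s] in
[z], where a constant is added to reach the value [1] at [z = 1]. Correcting by
a constant rather than by a factor leaves the derivative untouched. *)
Definition taylor_test s : 'rV[R]_N.+1 :=
  \row_i ((((i == 0)%:R * (cosh s - (cosh_trunc N.+1).[s]))
           + s ^+ (2 * i) / (2 * i)`!%:R) / cosh s).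

Lemma trial_taylor s :
  trial (taylor_test s) =
  (cosh s)^-1 *: ((cosh s - (cosh_trunc N.+1).[s])%:P
                  + (cosh_trunc N.+1 \Po (s *: 'X))).
Proof.
rewrite /trial /cosh_trunc raddf_sum scalerDr scaler_sumr /=.
have -> : (cosh s)^-1 *: (cosh s - (cosh_trunc N.+1).[s])%:P =
  \sum_(i < N.+1) ((i == 0)%:R * (cosh s - (cosh_trunc N.+1).[s]) / cosh s)
    *: 'X^(2 * i) :> {poly R}.
  rewrite (bigD1 0) //= big1 ?addr0 => [|i /negbTE ->].
    by rewrite mul1r muln0 expr0 alg_polyC scale_polyC mulrC.
  by rewrite !mul0r scale0r.
rewrite -big_split; apply: eq_bigr => i _ /=.
rewrite mxE comp_polyZ comp_Xn_poly exprZn !scalerA -scalerDl; congr (_ *: _).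
by rewrite mulrDl; congr (_ + _); ring.
Qed.

Lemma trial_taylor1 s : (trial (taylor_test s)).[1] = 1.
Proof.
rewrite trial_taylor hornerZ hornerD hornerC horner_comp hornerZ hornerX mulr1.
by rewrite subrK mulVf // gt_eqF // cosh_gt0.
Qed.

(** The test function differs from [w] by at most [2 e s^(2N+2)] and its
derivative from [w'] by at most [e s^(2N+2)]; as [s <= 1], the energy of the
difference is at most the sum [4 + 1 = 5] of the squares. *)
Lemma galerkin_upper s : 0 < s <= 1 ->
  qform (A evens s) (taylor_test s) <=
    s * tanh s + 5 * expR 1 ^+ 2 * s ^+ (4 * N + 4).
Proof.
move=> /andP[s0 s1]; have ch1 := cosh_ge1 s; have chgt0 := cosh_gt0 s.
have chn0 : cosh s != 0 by rewrite gt_eqF.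
set K := expR 1; have K0 : 0 <= K by exact: expR_ge0.
have P1 : (trial (taylor_test s)).[1] = 1 by exact: trial_taylor1.
have [c /andP[c0 c1]] := energy_gap (deriv_energy s _) (energy0 s _) P1.
rewrite energy1 -lerBlDl => ->.
have [hc _] := @hyperbolic_remainder R N.+1.
have [_ hs] := @hyperbolic_remainder R N.
have sc0 : 0 <= s * c by rewrite mulr_ge0 // ltW.
have scs : s * c <= s by rewrite ler_piMr // ltW.
have sc1 : 0 <= s * c <= 1 by rewrite sc0 (le_trans scs).
have s01 : 0 <= s <= 1 by rewrite ltW.
have div_le (y b : R) : `|y| <= b -> `|y / cosh s| <= b.
  move=> yb; rewrite normrM normfV (gtr0_norm chgt0).
  rewrite ler_pdivrMr //; apply: (le_trans yb); rewrite ler_peMr //.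
  exact: le_trans (normr_ge0 y) yb.
have b1 : `|(trial (taylor_test s)).[c] - cosh (s * c) / cosh s|
    <= 2 * (K * s ^+ (2 * N.+1)).
  rewrite trial_taylor hornerZ hornerD hornerC horner_comp hornerZ hornerX.
  rewrite [_^-1 * _]mulrC -mulrBl; apply: div_le.
  have := hc _ s01; have := hc _ sc1.
  have : K * (s * c) ^+ (2 * N.+1) <= K * s ^+ (2 * N.+1).
    by apply: ler_wpM2l => //; apply: lerXn2r; rewrite ?nnegrE // ltW.
  rewrite -/K; move: (_ ^+ _) (_ ^+ _) => X Y; rewrite !ler_norml; lra.
have b2 : `|(trial (taylor_test s))^`().[c] - s * sinh (s * c) / cosh s|
    <= K * s ^+ (2 * N.+1).
  rewrite trial_taylor derivZ derivD derivC add0r deriv_comp deriv_cosh_trunc.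
  rewrite derivZ derivX hornerZ hornerM horner_comp !hornerZ hornerX hornerC mulr1.
  rewrite [_^-1 * _]mulrC -mulrBl; apply: div_le.
  rewrite [_ * s]mulrC -mulrBr normrM distrC (gtr0_norm s0).
  rewrite mulnS addSn add1n exprS mulrCA.
  apply: ler_wpM2l; first exact: ltW.
  apply: le_trans (hs _ sc1) _; apply: ler_wpM2l => //.
  by apply: lerXn2r; rewrite ?nnegrE // ltW.
have -> : s ^+ (4 * N + 4) = (s ^+ (2 * N.+1)) ^+ 2.
  by rewrite -exprM; congr (_ ^+ _); lia.
have sq (y b : R) : `|y| <= b -> y ^+ 2 <= b ^+ 2.
  move=> yb; rewrite -[y ^+ 2]real_normK ?num_real //; apply: lerXn2r => //.
  by rewrite nnegrE (le_trans _ yb).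
have := sq _ _ b1; have := sq _ _ b2.
set Y := (_ - _) ^+ 2; set Z := (_ - _) ^+ 2; set W := s ^+ (2 * N.+1) => hY hZ.
have ss : s ^+ 2 <= 1 by rewrite expr_le1 // ltW.
have Z0 : 0 <= Z by exact: sqr_ge0.
have : s ^+ 2 * Z <= Z by rewrite ler_piMl.
by move: hY hZ; rewrite !exprMn; lra.
Qed.

Lemma qform_delta (M : 'M[R]_N.+1) i : qform M (delta_mx 0 i) = M i i.
Proof. by rewrite /qform trmx_delta -rowE -colE !mxE. Qed.

(** The three bounds on the minimal energy: below by the minimum over all
functions, above by the test function [1] and by [taylor_test]. *)
Lemma galerkin s : 0 < s -> exists a : R,
  [/\ a * \det (Atilde evens s) = \det (A evens s),
      s * tanh s <= a, a <= s ^+ 2 &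
      s <= 1 -> a <= s * tanh s + 5 * expR 1 ^+ 2 * s ^+ (4 * N + 4)].
Proof.
move=> s0; have [a [u [su uA e]]] := bordered_solve (bordered_A_neq0 s).
have qu : qform (A evens s) u = a.
  by rewrite /qform (qform_eigen _ uA) su mulr1 mxE mulr1n.
have min t : \sum_i t 0 i = 1 -> a <= qform (A evens s) t.
  by move=> st; rewrite (qform_min (A_sym s) su uA st) lerDl qform_ge0.
exists a; split=> //.
- by rewrite -qu; exact: galerkin_lower.
- apply: le_trans (min (delta_mx 0 0) _) _.
    rewrite (bigD1 0) //= big1 => [|i /negbTE i0]; first by rewrite mxE eqxx addr0.
    by rewrite mxE i0 andbF.
  by rewrite qform_delta !mxE /evens muln0 !add0r invr1 mulr1 !mul0r addr0.
move=> s1; have s01 : 0 < s <= 1 by rewrite s0.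
apply: le_trans (galerkin_upper s01); apply: min.
by rewrite -trial1 trial_taylor1.
Qed.

End Energy.

(** * The squared phase speed against [tanh s / s] *)

Section Ratio.
Context {R : realType} (N : nat).
Implicit Types s : R.

Let p : 'I_N.+1 -> nat := evens (N := N).

Definition speed_ratio s : R := (IKnum R p).[s ^+ 2] / (IKden R p).[s ^+ 2].

Lemma IKden_neq0 s : (IKden R p).[s ^+ 2] != 0.
Proof. by rewrite IKdenE; exact: bordered_A_neq0. Qed.

Lemma speed_ratioN s : speed_ratio (- s) = speed_ratio s.
Proof. by rewrite /speed_ratio sqrrN. Qed.

Lemma speed_ratio_bounds s : 0 < s ->
  [/\ tanhc s <= speed_ratio s, speed_ratio s <= 1 &
      s <= 1 -> speed_ratio s <= tanhc s + 5 * expR 1 ^+ 2 * s ^+ (4 * N + 2)].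
Proof.
move=> s0; have [a [e lo up near0]] := galerkin (N := N) s0.
have sn0 : s != 0 by rewrite gt_eqF.
have ratioE : s ^+ 2 * speed_ratio s = a.
  rewrite /speed_ratio IKnumE // IKdenE -e mulrA mulrA divff ?expf_neq0 //.
  by rewrite mul1r mulfK // bordered_A_neq0.
have tanhcE : s * tanh s = s ^+ 2 * tanhc s by rewrite -tanhc_mul; ring.
have s2 : 0 < s ^+ 2 by rewrite exprn_gt0.
move: lo up near0; rewrite -{}ratioE {}tanhcE.
have -> : s ^+ (4 * N + 4) = s ^+ 2 * s ^+ (4 * N + 2).
  by rewrite -exprD; congr (_ ^+ _); lia.
rewrite [_ * (s ^+ 2 * _)]mulrCA -mulrDr ler_pM2l //.
rewrite -{2}[s ^+ 2]mulr1 ler_pM2l //.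
by move=> lo up near0; split=> // /near0; rewrite ler_pM2l.
Qed.

(** From [sinh s = s + O(s^3)] and [cosh s = 1 + O(s^2)]. *)
Lemma tanhc_near1 s : 0 < s <= 1 -> 1 - 2 * expR 1 * s ^+ 2 <= tanhc s.
Proof.
move=> /andP[s0 s1]; have s01 : 0 <= s <= 1 by rewrite ltW.
have chgt0 := cosh_gt0 s; have chge1 := cosh_ge1 s.
have [hc hs] := @hyperbolic_remainder R 1.
have := hc _ s01; have := hs _ s01.
rewrite /cosh_trunc /sinh_trunc !big_ord1 !hornerZ !hornerXn !muln0 !fact0 !factS.
rewrite !invr1 expr0 expr1 !mul1r muln1.
set K := expR 1; rewrite !ler_norml => /andP[hs1 _] /andP[_ hc1].
have -> : tanhc s = sinh s / (s * cosh s).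
  by rewrite /tanhc gt_eqF // tanh_cosh -mulrA -invfM [s * _]mulrC.
rewrite ler_pdivlMr; last exact: mulr_gt0.
have K0 : 0 <= K by exact: expR_ge0.
have : s * (cosh s - 1) <= s * (K * s ^+ 2) by rewrite ler_pM2l.
have : 0 <= 2 * K * s ^+ 2 * (s * (cosh s - 1)).
  by rewrite !mulr_ge0 ?sqr_ge0 ?subr_ge0 // ltW.
move: hs1; rewrite (_ : s ^+ (2 * 1).+1 = s * s ^+ 2) ?exprS //.
nra.
Qed.

(** This identifies the ratio at [s = 0]: there the Galerkin energy is [0], and
its quotient by [s^2] is known only as a value of polynomials in [s^2]. *)
Lemma poly_limit0 (q d : {poly R}) (K : R) :
  (forall x, 0 < x <= 1 -> `|q.[x]| <= `|d.[x]| * (K * x)) -> q.[0] = 0.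
Proof.
move=> b; apply/eqP; rewrite -normr_eq0 -oppr_eq0 eq_le oppr_le0 normr_ge0 /=.
pose f x := `|d.[x]| * (K * x) - `|q.[x]|.
have cf : f x @[x --> 0^'+] --> - `|q.[0]|.
  have -> : - `|q.[0]| = `|d.[0]| * (K * 0) - `|q.[0]| by rewrite !mulr0 sub0r.
  apply: cvg_at_right_filter; apply: cvgB; last first.
    by apply: cvg_norm; exact: continuous_horner.
  apply: cvgM; first by apply: cvg_norm; exact: continuous_horner.
  by apply: cvgM; [exact: cvg_cst|exact: cvg_id].
apply: (cvgr_to_ge cf); near=> x; rewrite /f subr_ge0; apply: b.
by apply/andP; split; near: x; [exact: nbhs_right_gt|apply: nbhs_right_le].
Unshelve. all: by end_near. Qed.

(** For small [s > 0] the ratio lies between [tanhc s] and [1], hence within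
[O(s^2)] of [1]: as polynomials in [s^2], numerator and denominator have the
same value at [0]. *)
Lemma speed_ratio0 : speed_ratio 0 = 1.
Proof.
have h : (IKden R p - IKnum R p).[0] = 0.
  apply: (@poly_limit0 _ (IKden R p) (2 * expR 1)) => x /andP[x0 x1].
  pose s := Num.sqrt x; have s0 : 0 < s by rewrite sqrtr_gt0.
  have s1 : s <= 1 by rewrite -sqrtr1 ler_wsqrtr.
  have xE : x = s ^+ 2 by rewrite sqr_sqrtr // ltW.
  have [lo up _] := speed_ratio_bounds s0.
  have s01 : 0 < s <= 1 by rewrite s0.
  have tn := tanhc_near1 s01.
  rewrite hornerD hornerN {}xE.
  have -> : (IKden R p).[s ^+ 2] - (IKnum R p).[s ^+ 2] =
     (IKden R p).[s ^+ 2] * (1 - speed_ratio s).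
    by rewrite mulrBr mulr1 [_ * speed_ratio s]mulrC divfK // IKden_neq0.
  rewrite normrM ler_wpM2l // ger0_norm ?subr_ge0 //; lra.
have := IKden_neq0 0; rewrite /speed_ratio expr0n /= => d0.
move: h; rewrite hornerD hornerN => /eqP; rewrite subr_eq0 => /eqP <-.
by rewrite divff.
Qed.

Lemma tanhc_ge0 s : 0 <= tanhc s.
Proof.
have pos t : 0 < t -> 0 <= tanhc t.
  move=> t0; rewrite /tanhc gt_eqF // divr_ge0 // ?(ltW t0) // tanh_cosh.
  rewrite divr_ge0 ?(ltW (cosh_gt0 _)) // /sinh divr_ge0 // subr_ge0 ler_expR; lra.
have [s0|s0|->] := ltrgt0P s; first exact: pos.
  by rewrite -tanhcN; apply: pos; rewrite oppr_gt0.
by rewrite /tanhc eqxx.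
Qed.

(** For [s > 1] both quantities lie between [0] and [1], whence the summand [1]
in the constant; negative [s] are covered by evenness. *)
Lemma speed_ratio_tanhc s :
  0 <= speed_ratio s - tanhc s <= (5 * expR 1 ^+ 2 + 1) * `|s| ^+ (4 * N + 2).
Proof.
have K0 : 0 <= 5 * expR 1 ^+ 2 :> R by rewrite mulr_ge0 ?sqr_ge0.
have pos t : 0 < t ->
    0 <= speed_ratio t - tanhc t <= (5 * expR 1 ^+ 2 + 1) * t ^+ (4 * N + 2).
  move=> t0; have [lo up near0] := speed_ratio_bounds t0.
  have tm : 0 <= t ^+ (4 * N + 2) by rewrite exprn_ge0 // ltW.
  rewrite subr_ge0 lo /=; have [/near0|t1] := leP t 1; first by lra.
  have tge1 : 1 <= t ^+ (4 * N + 2) by rewrite exprn_ege1 // ltW.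
  have tc0 := tanhc_ge0 t.
  nra.
have [s0|s0|->] := ltrgt0P s.
- by exact: pos.
- by rewrite -speed_ratioN -tanhcN; apply: pos; rewrite oppr_gt0.
- by rewrite speed_ratio0 /tanhc eqxx subrr expr0n addn2 mulr0 lexx.
Qed.

Lemma speed_ratio_ge0 s : 0 <= speed_ratio s.
Proof. by have := tanhc_ge0 s; have := speed_ratio_tanhc s; lra. Qed.

End Ratio.

(** * Analyticity of [tanh s / s] *)

Section Analytic.
Context {R : realType}.
Implicit Types (a b c : nat -> R) (s : R).

Lemma pseries_horner a s n : pseries a s n = (\poly_(k < n) a k).[s].
Proof. by rewrite horner_poly /pseries /series /= big_mkord. Qed.

(** The first [n] coefficients of the quotient of power series [c / b] with
[b 0 = 1]. Each coefficient depends on all the preceding ones, so the whole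
list is computed. *)
Fixpoint quotient_prefix b c (n : nat) : seq R :=
  if n is m.+1 then
    let l := quotient_prefix b c m in
    rcons l (c m - \sum_(k < m) l`_k * b (m - k)%N)
  else [::].

Definition quotient_coef b c n : R := (quotient_prefix b c n.+1)`_n.

Lemma size_quotient_prefix b c n : size (quotient_prefix b c n) = n.
Proof. by elim: n => // n ih; rewrite /= size_rcons ih. Qed.

Lemma nth_quotient_prefix b c n k :
  (k < n)%N -> (quotient_prefix b c n)`_k = quotient_coef b c k.
Proof.
elim: n => // n ih; rewrite ltnS leq_eqVlt => /predU1P[->//|kn].
by rewrite /= nth_rcons size_quotient_prefix kn ih.
Qed.

Lemma quotient_coefE b c n : b 0%N = 1 ->
  \sum_(k < n.+1) quotient_coef b c k * b (n - k)%N = c n.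
Proof.
move=> b0; rewrite big_ord_recr /= subnn b0 mulr1.
have -> : quotient_coef b c n =
    c n - \sum_(k < n) quotient_coef b c k * b (n - k)%N.
  rewrite {1}/quotient_coef /= nth_rcons size_quotient_prefix ltnn eqxx.
  by congr (_ - _); apply: eq_bigr => k _; rewrite nth_quotient_prefix.
by rewrite addrC subrK.
Qed.

(** By induction [|a_n| <= 1 + (1 + 2 + ... + 2^(n-1)) = 2^n]. *)
Lemma quotient_coef_le b c n : b 0%N = 1 ->
  (forall k, `|b k| <= 1) -> (forall k, `|c k| <= 1) ->
  `|quotient_coef b c n| <= 2 ^+ n.
Proof.
move=> b0 b1 c1; elim/ltn_ind: n => n ih.
have := quotient_coefE c n b0.
rewrite big_ord_recr /= subnn b0 mulr1 => /(canRL (addKr _)) ->.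
apply: le_trans (ler_normD _ _) _; rewrite normrN.
have -> : 2 ^+ n = \sum_(k < n) 2 ^+ k + 1 :> R.
  by rewrite -[2 ^+ n](subrK 1) subrX1 (_ : 2 - 1 = 1) ?mul1r //; ring.
apply: lerD => //; apply: le_trans (ler_norm_sum _ _ _) _; apply: ler_sum => k _.
by rewrite normrM -[leRHS]mulr1 ler_pM // ih.
Qed.

(** The product of the two truncations agrees with the truncation of [c] below
order [n]; from order [n] on, its [k]-th coefficient is at most [2 * 2^k]. With
[|s| <= 1/8] the [k]-th term is at most [2 * 4^(-k) <= 2 * 2^(-n) * 2^(-k)], and
summing over [k] gives the bound. *)
Lemma quotient_residual b c n s : b 0%N = 1 ->
  (forall k, `|b k| <= 1) -> (forall k, `|c k| <= 1) -> `|s| <= 8^-1 ->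
  `|pseries (quotient_coef b c) s n * pseries b s n - pseries c s n|
    <= 4 * 2^-1 ^+ n.
Proof.
move=> b0 b1 c1 s8; set a := quotient_coef b c.
have half0 : 0 <= 2^-1 :> R by rewrite invr_ge0.
rewrite !pseries_horner -hornerM -hornerN -hornerD; set q := _ - _.
have cq k : `|q`_k| * `|s| ^+ k <= 2 * (2^-1 ^+ n * 2^-1 ^+ k).
  have [kn|nk] := ltnP k n.
    suff -> : q`_k = 0 by rewrite normr0 mul0r !mulr_ge0 ?exprn_ge0.
    rewrite coefB coefM coef_poly kn -(quotient_coefE c k b0); apply/eqP.
    rewrite subr_eq0; apply/eqP; apply: eq_bigr => j _.
    by rewrite !coef_poly !(leq_ltn_trans _ kn) ?leq_subr // -ltnS.
  have q2 : `|q`_k| <= 2 * 2 ^+ k.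
    rewrite coefB coefM [X in _ - X]coef_poly ltnNge nk subr0.
    apply: le_trans (ler_norm_sum _ _ _) _.
    apply: (@le_trans _ _ (\sum_(j < k.+1) 2 ^+ j)); last first.
      have := subrX1 (2 : R) k.+1; rewrite (_ : 2 - 1 = 1) ?mul1r; last by ring.
      by move=> <-; rewrite exprS lerBlDr lerDl.
    apply: ler_sum => j _; rewrite normrM -[leRHS]mulr1 ler_pM //.
      rewrite coef_poly; case: ifP => _; first exact: quotient_coef_le.
      by rewrite normr0 exprn_ge0.
    by rewrite coef_poly; case: ifP => _; rewrite ?normr0.
  have s8k : `|s| ^+ k <= 8^-1 ^+ k by apply: lerXn2r; rewrite ?nnegrE ?invr_ge0.
  apply: le_trans (ler_pM (normr_ge0 _) _ q2 s8k) _; first by rewrite exprn_ge0.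
  rewrite -mulrA ler_pM2l // -exprMn (_ : 2 / 8 = 2^-1 * 2^-1); last by field.
  rewrite exprMn ler_wpM2r ?exprn_ge0 //.
  by apply: ler_wiXn2l => //; rewrite invf_le1 ?ler1n.
rewrite horner_coef; apply: le_trans (ler_norm_sum _ _ _) _.
apply: (@le_trans _ _ (\sum_(k < size q) 2 * (2^-1 ^+ n * 2^-1 ^+ k))).
  by apply: ler_sum => k _; rewrite normrM normrX.
rewrite -mulr_sumr -mulr_sumr (_ : 4 = 2 * 2 :> R); last by ring.
rewrite -mulrA ler_pM2l // [leRHS]mulrC ler_wpM2l ?exprn_ge0 //.
have := subrX1 (2^-1 : R) (size q); set S := \sum_(i < _) _.
have : 0 <= (2^-1 : R) ^+ size q by rewrite exprn_ge0.
by lra.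
Qed.

(** The partial sums of the quotient times those of [b] approach those of [c]
by [quotient_residual], and the partial sums of [b] have a nonzero limit. *)
Lemma analytic_div b c (B C : R -> R) : b 0%N = 1 ->
  (forall k, `|b k| <= 1) -> (forall k, `|c k| <= 1) ->
  (forall s, pseries b s @ \oo --> B s) ->
  (forall s, pseries c s @ \oo --> C s) ->
  (forall s, B s != 0) -> analytic_at0 (fun s => C s / B s).
Proof.
move=> b0 b1 c1 cb cc Bn0; exists (quotient_coef b c), 8^-1; split.
  by rewrite invr_gt0.
move=> s /ltW s8; set a := quotient_coef b c.
have res : (fun n => pseries a s n * pseries b s n - pseries c s n) @ \oo
    --> (0 : R).
  apply/norm_cvg0P.
  have geo : (fun n => 4 * 2^-1 ^+ n : R) @ \oo --> (0 : R).
    rewrite -[0 in X in _ --> X](mulr0 4); apply: cvgM; first exact: cvg_cst.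
    apply: cvg_expr.
    by rewrite ger0_norm ?invr_ge0 // invf_lt1 ?ltr1n.
  apply: (squeeze_cvgr _ (cvg_cst 0) geo); near=> n.
  by rewrite normr_ge0 /=; exact: quotient_residual.
have prod : (fun n => pseries a s n * pseries b s n) @ \oo --> C s.
  rewrite -[C s]add0r; apply: cvg_trans (cvgD res (cc s)).
  by apply: near_eq_cvg; near=> n; rewrite !fctE subrK.
apply: cvg_trans (cvgM prod (cvgV (Bn0 s) (cb s))).
apply: near_eq_cvg; near=> n; rewrite /= /unstable.inv_fun mulfK //.
near: n; exact: (cvgr_neq0 _ (cb s)).
Unshelve. all: by end_near. Qed.

Lemma analyticZ (k : R) (f : R -> R) :
  analytic_at0 f -> analytic_at0 (fun s => k * f s).
Proof.
move=> [a [r [r0 ha]]]; exists (fun n => k * a n), r; split=> // s sr.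
apply: cvg_trans (cvgM (cvg_cst k) (ha s sr)); apply: near_eq_cvg; near=> n.
by rewrite /pseries /series /= mulr_sumr; apply: eq_bigr => i _; rewrite mulrA.
Unshelve. all: by end_near. Qed.

(** Since [tanh s = (exp (2 s) - 1) / (exp (2 s) + 1)], one has
[tanh s / s = f / (1 + s f)] with [f = (exp (2 s) - 1) / (2 s)], whose
coefficients [2^k / (k + 1)!] are bounded by [1]. *)
Definition expm1c_coef k : R := 2 ^+ k / (k.+1)`!%:R.
Definition exp1_coef k : R := if k is j.+1 then expm1c_coef j else 1.
Definition expm1c s : R := if s == 0 then 1 else (expR (2 * s) - 1) / (2 * s).

Lemma expm1c_coef_le1 k : `|expm1c_coef k| <= 1.
Proof.
have k0 : 0 < k.+1`!%:R :> R by rewrite ltr0n fact_gt0.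
rewrite ger0_norm; last by rewrite divr_ge0 ?exprn_ge0 // ltW.
rewrite ler_pdivrMr // mul1r -natrX ler_nat.
elim: k {k0} => // k ih; rewrite expnS factS leq_mul //.
Qed.

Lemma pseries_expm1c s : pseries expm1c_coef s @ \oo --> expm1c s.
Proof.
rewrite /expm1c; have [->|s0] := eqVneq s 0.
  rewrite -cvg_shiftS; apply: cvg_near_cst; near=> n.
  rewrite /= pseries_horner horner_poly big_ord_recl big1 => [|i _].
    by rewrite /expm1c_coef !expr0 factS fact0 muln1 !mulr1 invr1 addr0 mulr1.
  by rewrite expr0n mulr0.
have e2 : series (exp_coeff (2 * s)) @ \oo --> expR (2 * s).
  exact: is_cvg_series_exp_coeff.
rewrite -cvg_shiftS in e2.
have lim : (series (exp_coeff (2 * s)) n.+1 - 1) / (2 * s) @[n --> \oo] -->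
    (expR (2 * s) - 1) / (2 * s).
  by apply: cvgM; [apply: cvgB; [exact: e2|exact: cvg_cst]|exact: cvg_cst].
apply: cvg_trans lim; apply: near_eq_cvg; near=> n.
apply: (canLR (mulfK _)); first by rewrite mulf_neq0.
rewrite /series /pseries /= !big_mkord big_ord_recl.
rewrite [exp_coeff _ _](_ : _ = 1); last by rewrite /exp_coeff /= expr0 fact0 divr1.
rewrite addrAC subrr add0r mulr_suml big_mkord; apply: eq_bigr => i _.
by rewrite /exp_coeff /= /expm1c_coef exprMn !exprS; ring.
Unshelve. all: by end_near. Qed.

Lemma pseries_one_add_expm1c s : pseries exp1_coef s @ \oo --> 1 + s * expm1c s.
Proof.
rewrite -cvg_shiftS.
have lim : 1 + s * pseries expm1c_coef s n @[n --> \oo] --> 1 + s * expm1c s.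
  apply: cvgD; first exact: cvg_cst.
  by apply: cvgM; [exact: cvg_cst|exact: pseries_expm1c].
apply: cvg_trans lim; apply: near_eq_cvg; near=> n.
rewrite /= !pseries_horner !horner_poly [RHS]big_ord_recl expr0 mulr1; congr (_ + _).
by rewrite mulr_sumr; apply: eq_bigr => i _; rewrite exprS mulrCA.
Unshelve. all: by end_near. Qed.

Lemma one_add_expm1cE s : 1 + s * expm1c s = (expR (2 * s) + 1) / 2.
Proof.
rewrite /expm1c; case: eqP => [->|/eqP s0]; first by rewrite mulr0 expR0; field.
by field.
Qed.

Lemma tanhc_expm1c s : tanhc s = expm1c s / (1 + s * expm1c s).
Proof.
rewrite one_add_expm1cE /tanhc /expm1c; case: eqP => [->|/eqP s0].
  by rewrite mulr0 expR0; field.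
have e0 := expR_gt0 s.
rewrite (_ : expR (2 * s) = expR s * expR s); last first.
  by rewrite -expRD; congr expR; ring.
rewrite /tanh expRN.
move: (expR s) e0 => e e0.
have p0 : 0 < e * e + 1 by rewrite addr_gt0 // mulr_gt0.
by field; rewrite s0 !gt_eqF.
Qed.

Lemma tanhc_analytic : analytic_at0 (@tanhc R).
Proof.
have -> : @tanhc R = fun s => expm1c s / (1 + s * expm1c s).
  by apply/funext => s; exact: tanhc_expm1c.
apply: (@analytic_div exp1_coef expm1c_coef) => //.
- by case=> [|k] /=; [rewrite normr1|exact: expm1c_coef_le1].
- exact: expm1c_coef_le1.
- exact: pseries_one_add_expm1c.
- exact: pseries_expm1c.
by move=> s; rewrite one_add_expm1cE gt_eqF // divr_gt0 // addr_gt0 // expR_gt0.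
Qed.

End Analytic.

(** * Order of approximation and Pade property *)

Theorem theorem2 (R : realType) (N : nat) (hN : (1 <= N)%N) :
  exists C : R, 0 < C /\
    forall p : 'I_N.+1 -> nat, (forall i : 'I_N.+1, p i = (2 * i)%N) ->
      (forall (bWW bIK : bool) (g h : R), 0 < g -> 0 < h ->
         is_pade (2 * N) (2 * N)
           (fun s : R => cWW_of bWW g h s ^+ 2)
           (fun s : R => cIK_of p bIK g h s ^+ 2)) /\
      (forall (n : nat), (1 <= n)%N ->
         forall (bWW bIK : bool) (g h : R), 0 < g -> 0 < h ->
         forall xi : 'rV[R]_n,
           `| (cWW bWW g h xi / Num.sqrt (g * h)) ^+ 2
              - (cIK p bIK g h xi / Num.sqrt (g * h)) ^+ 2 |
           <= C * (h * enorm xi) ^+ (4 * N + 2)).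
Proof.
have sqE (b : bool) (x : R) : 0 <= x -> ((-1) ^+ b * Num.sqrt x) ^+ 2 = x.
  by move=> x0; rewrite exprMn sqrr_sign mul1r sqr_sqrtr.
pose C : R := 5 * expR 1 ^+ 2 + 1.
have C0 : 0 < C by rewrite ltr_pwDr // mulr_ge0 ?sqr_ge0.
exists C; split=> // p pE.
have {pE p} -> : p = evens (N := N) by apply/funext => i; exact: pE.
have cWWE b (g h s : R) : 0 < g -> 0 < h -> cWW_of b g h s ^+ 2 = g * h * tanhc s.
  by move=> g0 h0; rewrite /cWW_of sqE // mulr_ge0 ?tanhc_ge0 // ltW // mulr_gt0.
have cIKE b (g h s : R) : 0 < g -> 0 < h ->
    cIK_of (evens (N := N)) b g h s ^+ 2 = g * h * speed_ratio N s.
  move=> g0 h0; rewrite /cIK_of -/(speed_ratio N s) sqE //.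
  by rewrite mulr_ge0 ?speed_ratio_ge0 // ltW // mulr_gt0.
split=> [bWW bIK g h g0 h0|n _ bWW bIK g h g0 h0 xi]; last first.
  have gh0 : 0 < g * h by rewrite mulr_gt0.
  rewrite !expr_div_n cWWE // cIKE // sqr_sqrtr ?(ltW gh0) // ![g * h * _]mulrC.
  rewrite !mulfK ?gt_eqF // distrC; set s := h * enorm xi.
  have s0 : 0 <= s by rewrite mulr_ge0 ?sqrtr_ge0 // ltW.
  have /andP[lo up] := speed_ratio_tanhc N s.
  by rewrite ger0_norm // (le_trans up) // ger0_norm.
have gh0 : 0 < g * h by rewrite mulr_gt0.
split.
  have -> : (fun s => cWW_of bWW g h s ^+ 2) = (fun s => g * h * tanhc s).
    by apply/funext => s; exact: cWWE.
  exact/analyticZ/tanhc_analytic.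
have sizeX2 (q : {poly R}) : (size q <= N.+1)%N ->
    (size (q \Po 'X^2) <= (2 * N).+1)%N.
  move=> qN; apply: leq_trans (size_comp_poly_leq _ _) _.
  rewrite size_polyXn /= ltnS mulnC leq_mul2l /=.
  by case: (size q) qN.
exists ((g * h) *: (IKnum R (evens (N := N)) \Po 'X^2)),
  (IKden R (evens (N := N)) \Po 'X^2).
have ratioE s : ((g * h) *: (IKnum R (evens (N := N)) \Po 'X^2)).[s]
    / (IKden R (evens (N := N)) \Po 'X^2).[s] = g * h * speed_ratio N s.
  by rewrite hornerZ !horner_comp hornerXn -mulrA.
split.
- by rewrite (leq_trans (size_scale_leq _ _)) // sizeX2 // size_IKnum.
- by rewrite sizeX2 // size_IKden.
- by rewrite horner_comp hornerXn IKden_neq0.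
- by move=> s; rewrite ratioE cIKE.
apply/eqO_exP; exists (g * h * C); first by rewrite mulr_gt0.
have near1 : \forall s \near (0 : R), `|s| <= 1 by exact: nbhs0_le.
apply: filterS near1 => s s1.
rewrite ratioE cWWE // -mulrBr normrM (gtr0_norm gh0) -[leRHS]mulrA.
rewrite ler_pM2l // distrC; have /andP[lo up] := speed_ratio_tanhc N s.
rewrite ger0_norm // (le_trans up) // ler_pM2l // normrX.
by apply: ler_wiXn2l => //; lia.
Qed.
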